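(* There exists a class of finite structures definable by a monadic linear Boolean Datalog program that is not decided by any adaptive left unbounded query algorithm over $\mathbb{B}$.
   Context: Structures are finite relational structures with non-empty domain over a finite signature $\tau$; $\mathsf{FIN}(\tau)$ is the class of all of them. A Boolean Datalog program is a finite set of rules $H\leftarrow B_1,\dots,B_m$ whose heads are atoms over intensional (recursive) predicates not in $\tau$, whose bodies are atoms over $\tau$ and the intensional predicates (and possibly equalities), with a distinguished $0$-ary goal predicate; it defines the class of structures on which the goal predicate is derived in the least fixpoint semantics. It is monadic if all intensional predicates other than the goal are unary, and linear if every rule body contains at most one occurrence of an intensional predicate. $\hom_{\mathbb{B}}(F,D)$ is $1$ if there is a homomorphism $F\to D$ and $0$ otherwise. For a set $\Sigma$, $\Sigma^{<\omega}$ is the set of finite strings over $\Sigma$; a subtree is a prefix-closed subset, a leaf an element with no proper extension. An adaptive left unbounded query algorithm over $\mathbb{B}$ is a function $G:\mathcal{T}\to\mathsf{FIN}(\tau)\cup\{\mathsf{YES},\mathsf{NO}\}$ with $\mathcal{T}\subseteq\{0,1\}^{<\omega}$ a subtree and $G(\sigma)\in\{\mathsf{YES},\mathsf{NO}\}$ iff $\sigma$ is a leaf; its computation path on $D$ is the limit of $\sigma_0=\varepsilon$, $\sigma_{i+1}=\sigma_i$ if $G(\sigma_i)\in\{\mathsf{YES},\mathsf{NO}\}$, else $\sigma_{i+1}=\sigma_i\bullet\hom_{\mathbb{B}}(G(\sigma_i),D)$; it must be total (finite path on every input) and decides $\{D:G(\text{path of }D)=\mathsf{YES}\}$. *)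

(* Defs.v *)
From Stdlib Require List.
From mathcomp Require Import all_boot.

Set Implicit Arguments.
Unset Strict Implicit.
Unset Printing Implicit Defensive.

Record signature := Signature {
  symbol : finType;
  arity : symbol -> nat
}.

Record structure (tau : signature) := Structure {
  dom :> finType;
  dom_nonempty : 0 < #|dom|;
  interp : forall R : symbol tau, {set (arity R).-tuple dom}
}.

Definition is_hom (tau : signature) (F D : structure tau) (h : F -> D) : bool :=
  [forall R : symbol tau, forall t in interp F R,
     map_tuple h t \in interp D R].

Definition homB (tau : signature) (F D : structure tau) : bool :=
  [exists h : {ffun F -> D}, is_hom h].

(* The intensional predicates of a program are the elements of [option idb]:
   [None] is the goal, [Some q] the other ones. *)
Definition pred_arity (idb : finType) (idb_arity : idb -> nat)
    (p : option idb) : nat :=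
  if p is Some q then idb_arity q else 0.

(* Variables are natural numbers. *)
Variant atom (tau : signature) (idb : finType) (idb_arity : idb -> nat) :=
  | EdbAtom (R : symbol tau) of (arity R).-tuple nat
  | IdbAtom (p : option idb) of (pred_arity idb_arity p).-tuple nat
  | EqAtom of nat & nat.

Arguments EdbAtom {tau idb idb_arity} R _.
Arguments IdbAtom {tau idb idb_arity} p _.
Arguments EqAtom {tau idb idb_arity} _ _.

Record rule (tau : signature) (idb : finType) (idb_arity : idb -> nat) := Rule {
  head_pred : option idb;
  head_args : (pred_arity idb_arity head_pred).-tuple nat;
  body : seq (atom tau idb_arity)
}.

Record program (tau : signature) := Program {
  idb : finType;
  idb_arity : idb -> nat;
  rules : seq (rule tau idb_arity)
}.

Arguments idb_arity {tau} p _.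

(* The least fixpoint of the rules of [P] on [D]. *)
Inductive derived (tau : signature) (P : program tau) (D : structure tau) :
    forall p : option (idb P), (pred_arity (idb_arity P) p).-tuple D -> Prop :=
  | Derived (r : rule tau (idb_arity P)) (v : nat -> D) of
      List.In r (rules P)
    & (forall R t, List.In (EdbAtom R t) (body r) ->
         map_tuple v t \in interp D R)
    & (forall p t, List.In (IdbAtom p t) (body r) ->
         derived (map_tuple v t))
    & (forall x y, List.In (EqAtom x y) (body r) -> v x = v y)
    : derived (map_tuple v (head_args r)).

Definition accepts (tau : signature) (P : program tau) (D : structure tau) : Prop :=
  @derived tau P D None [tuple].

Definition monadic (tau : signature) (P : program tau) : Prop :=
  forall q : idb P, idb_arity P q = 1.

Definition is_idb_atom (tau : signature) (idb : finType) (idb_arity : idb -> nat)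
    (a : atom tau idb_arity) : bool :=
  if a is IdbAtom _ _ then true else false.

Definition linear (tau : signature) (P : program tau) : Prop :=
  forall r, List.In r (rules P) ->
    count (@is_idb_atom tau (idb P) (idb_arity P)) (body r) <= 1.

Definition monadic_linear_datalog_definable (tau : signature)
    (C : structure tau -> Prop) : Prop :=
  exists P : program tau,
    [/\ monadic P, linear P & forall D, C D <-> accepts P D].

Variant label (tau : signature) :=
  | Query of structure tau
  | YES
  | NO.

Arguments YES {tau}.
Arguments NO {tau}.

Definition is_answer (tau : signature) (l : label tau) : bool :=
  if l is Query _ then false else true.

Definition prefix_closed (T : pred (seq bool)) : Prop :=
  forall s u : seq bool, prefix s u -> T u -> T s.

Definition is_leaf (T : pred (seq bool)) (s : seq bool) : Prop :=
  T s /\ forall u : seq bool, T u -> prefix s u -> u = s.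

(* A function on a subtree of [seq bool] is encoded as a partial function,
   equal to [None] exactly outside the subtree. *)
Definition tree_of (tau : signature) (G : seq bool -> option (label tau)) :
    pred (seq bool) := fun s => isSome (G s).

Record left_query_algorithm (tau : signature) := LeftQueryAlgorithm {
  node_label : seq bool -> option (label tau);
  tree_prefix_closed : prefix_closed (tree_of node_label);
  answer_iff_leaf : forall s l, node_label s = Some l ->
    (is_answer l <-> is_leaf (tree_of node_label) s)
}.

Definition comp_step (tau : signature) (A : left_query_algorithm tau)
    (D : structure tau) (s : seq bool) : seq bool :=
  if node_label A s is Some (Query F) then rcons s (homB F D) else s.

Definition comp_seq (tau : signature) (A : left_query_algorithm tau)
    (D : structure tau) (n : nat) : seq bool :=
  iter n (comp_step A D) [::].

(* The computation path on [D] is finite, equal to [s], and stays in the tree.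
   The latter is not automatic: an inner node may lack one of its children. *)
Definition comp_path (tau : signature) (A : left_query_algorithm tau)
    (D : structure tau) (s : seq bool) : Prop :=
  (exists N, forall n, N <= n -> comp_seq A D n = s)
  /\ tree_of (node_label A) s.

Definition total_algorithm (tau : signature) (A : left_query_algorithm tau) : Prop :=
  forall D : structure tau, exists s : seq bool, comp_path A D s.

Definition decides (tau : signature) (A : left_query_algorithm tau)
    (C : structure tau -> Prop) : Prop :=
  total_algorithm A /\
  forall D : structure tau,
    C D <-> exists s, comp_path A D s /\ node_label A s = Some YES.

(* Main.v *)
(** The program asks for a directed path from [P] to [Q].  Let [two_points] be
    a [P]-point and a [Q]-point, each with a loop and no other edge, and let
    [long_path n] be the directed path 0, ..., n with loops, [P] at 0 and [Q]
    at n.  The program accepts every [long_path n] but not [two_points].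
    However, [two_points] maps to [long_path n], and a structure with at most n
    elements that maps to [long_path n] misses a vertex, so that collapsing
    both sides of that vertex maps it to [two_points].  The finitely many
    queries made on [two_points] therefore have the same answers on
    [long_path n] for n large. *)
Require Import Defs.
From mathcomp Require Import all_boot.

Set Implicit Arguments.
Unset Strict Implicit.
Unset Printing Implicit Defensive.

Lemma homBP (tau : signature) (F D : structure tau) :
  reflect (exists h : F -> D, forall R t, t \in interp F R ->
             map_tuple h t \in interp D R)
          (homB F D).
Proof.
apply: (iffP existsP) => [[h /forallP hh]|[h hh]].
  by exists h => R t; apply/forall_inP: t; apply: hh.
exists (finfun h); apply/forallP => R; apply/forall_inP => t /hh.
suff -> : map_tuple (finfun h) t = map_tuple h t by [].
by apply: eq_from_tnth => i; rewrite !tnth_map ffunE.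
Qed.

Lemma homB_trans (tau : signature) (F D E : structure tau) :
  homB F D -> homB D E -> homB F E.
Proof.
move=> /homBP[h hh] /homBP[g hg]; apply/homBP; exists (g \o h) => R t /hh /hg.
suff -> : map_tuple (g \o h) t = map_tuple g (map_tuple h t) by [].
by apply: eq_from_tnth => i; rewrite !tnth_map.
Qed.

Section Indistinguishable.

Variables (tau : signature) (A : left_query_algorithm tau).

Definition query_card (s : seq bool) : nat :=
  if node_label A s is Some (Query F) then #|F| else 0.

(** Agreement is only required on queries met by the run on [D]: by induction the run on [D'] stands
    at the same node, so it asks the same query. *)
Lemma eq_comp_seq (D D' : structure tau) :
  (forall i F, node_label A (comp_seq A D i) = Some (Query F) ->
     homB F D' = homB F D) ->
  comp_seq A D' =1 comp_seq A D.
Proof.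
move=> eqDD'; elim=> // i IHi.
rewrite /comp_seq !iterS -!/(comp_seq A _ i) IHi /comp_step.
by case E: node_label => [[F||]|] //; rewrite (eqDD' _ _ E).
Qed.

Lemma decides_limit (C : structure tau -> Prop) (D : structure tau)
    (Dn : nat -> structure tau) :
  decides A C ->
  (forall n (F : structure tau), #|F| <= n -> homB F (Dn n) = homB F D) ->
  exists n, C (Dn n) <-> C D.
Proof.
move=> [totA decA] limD; have [s [[N stabN] _]] := totA D.
(* The run on [D] is constant from step [N] on, so its first [N.+1] nodes include all nodes it
   visits, and [n] bounds the size of every query asked. *)
pose n := \max_(i < N.+1) query_card (comp_seq A D i); exists n.
have eqD : comp_seq A (Dn n) =1 comp_seq A D.
  apply: eq_comp_seq => i F labF; apply: limD.
  suff [j jN jE]: exists2 j, j < N.+1 & comp_seq A D i = comp_seq A D j.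
    apply: leq_trans (leq_bigmax (Ordinal jN)).
    by rewrite /= -jE /query_card labF.
  have [iN|/ltnW Ni] := ltnP i N.+1; first by exists i.
  by exists N => //; rewrite !stabN.
have eqpath u : comp_path A (Dn n) u <-> comp_path A D u.
  by split=> -[[M hM] Tu]; split=> //; exists M => k /hM; rewrite eqD.
by split=> /decA[u [/eqpath pu ?]]; apply/decA; exists u.
Qed.

End Indistinguishable.

Definition satisfies (tau : signature) (P : program tau) (D : structure tau)
    (v : nat -> D) (a : atom tau (idb_arity P)) : Prop :=
  match a with
  | EdbAtom R t => map_tuple v t \in interp D R
  | IdbAtom p t => derived (map_tuple v t)
  | EqAtom x y => v x = v y
  end.

(** Comparing underlying sequences, not tuples, lets a rule conclude about a tuple that is not
    syntactically of the form [map_tuple v (head_args r)]. *)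
Lemma derived_rule (tau : signature) (P : program tau) (D : structure tau)
    (r : rule tau (idb_arity P)) (v : nat -> D)
    (t : (pred_arity (idb_arity P) (head_pred r)).-tuple D) :
  List.In r (rules P) -> (forall a, List.In a (body r) -> satisfies v a) ->
  t = map v (head_args r) :> seq D -> derived t.
Proof.
move=> rP sat tE; have -> : t = map_tuple v (head_args r) by apply: val_inj.
apply: Derived => //.
- by move=> R u /sat.
- by move=> p u /sat.
- by move=> x y /sat.
Qed.

(* [None] is the edge relation, [Some false] is P and [Some true] is Q. *)
Definition reach_sig : signature :=
  @Signature (option bool) (fun R => if R is Some _ then 1 else 2).

(* On a tuple of length 2, [sorted e] is [e] itself. *)
Definition reach_interp (T : finType) (lab : bool -> pred T) (e : rel T)
    (R : symbol reach_sig) : {set (arity R).-tuple T} :=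
  [set t : (arity R).-tuple T | if R is Some b then all (lab b) t
                                else sorted e t].

Definition reach_structure (T : finType) (T0 : 0 < #|T|)
    (lab : bool -> pred T) (e : rel T) : structure reach_sig :=
  @Structure reach_sig T T0 (reach_interp lab e).

Definition two_points : structure reach_sig :=
  @reach_structure bool (ltnW (eq_leq (esym card_bool))) (fun b => pred1 b) eq_op.

Definition long_path (n : nat) : structure reach_sig :=
  @reach_structure 'I_n.+1 (leq_trans (ltn0Sn n) (eq_leq (esym (card_ord _))))
    (fun b => pred1 (if b then ord_max else ord0)) (fun i j => i <= j <= i.+1).

(** The two points go to the ends of the path, whose loops receive their loops. *)
Lemma two_points_long_path n : homB two_points (long_path n).
Proof.
apply/homBP; exists (fun b : bool => if b then ord_max else ord0) => R t.
rewrite !inE; case: R t => [b|] t /=.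
  by rewrite all_map; apply: sub_all => c /= /eqP->.
by apply: homo_sorted => b c /eqP->; rewrite leqnn leqnSn.
Qed.

Lemma long_path_two_points n (F : structure reach_sig) :
  #|F| <= n -> homB F (long_path n) -> homB F two_points.
Proof.
move=> Fn /homBP[h hh].
(* Pigeonhole: the path has n+1 vertices and the image of [h] at most n. *)
have [k hk] : exists k, forall x, h x != k.
  have /subsetPn[k _ kh] : ~~ ('I_n.+1 \subset codom h).
    apply: contraL (leq_image_card h F) => /subset_leq_card.
    by rewrite card_ord -ltnNge => /(leq_trans _)->.
  by exists k => x; apply: contraNneq kh => <-; apply: codom_f.
apply/homBP; exists (fun x => k < h x) => R t /hh.
have allk : all (predC1 k) (map h t) by rewrite all_map; apply/allP => x _ /=.
have mapE : map (fun x => k < h x) t = map (fun i : 'I_n.+1 => k < i) (map h t).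
  by rewrite -map_comp.
rewrite !inE.
case: R t allk mapE => [b|] t allk /= ->.
  (* The P-end 0 is never above [k]; the Q-end n is, since it lies in the image of [h] and so
     differs from [k]. *)
  rewrite [all _ (map _ (map h t))]all_map => labt.
  apply/allP => i it; have := allP allk i it; have /eqP-> := allP labt i it.
  case: (b) => /= [neqk|_]; last by rewrite ltn0.
  by rewrite eqb_id ltn_neqAle -ltnS ltn_ord andbT eq_sym.
(* An edge advances by at most one, so it cannot jump over the missing vertex [k]: its ends lie on
   the same side. *)
apply: homo_sorted_in allk => i j; rewrite !inE -!val_eqE /= => ik jk.
move=> /andP[ij ji]; apply/eqP; apply/idP/idP => [|kj]; first by move/leq_trans->.
by rewrite ltn_neqAle eq_sym ik -ltnS (leq_trans kj).
Qed.

Lemma homB_long_path n (F : structure reach_sig) :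
  #|F| <= n -> homB F (long_path n) = homB F two_points.
Proof.
move=> Fn; apply/idP/idP => [|/homB_trans]; first exact: long_path_two_points.
by apply; apply: two_points_long_path.
Qed.

(** The single unary predicate [Some tt] is meant to hold of the vertices reachable from a
    P-point. *)
Definition init_rule : @rule reach_sig unit (fun=> 1) :=
  @Rule reach_sig unit (fun=> 1) (Some tt) [tuple 0]
    [:: @EdbAtom reach_sig _ _ (Some false) [tuple 0]].

Definition step_rule : @rule reach_sig unit (fun=> 1) :=
  @Rule reach_sig unit (fun=> 1) (Some tt) [tuple 1]
    [:: @IdbAtom reach_sig unit (fun=> 1) (Some tt) [tuple 0];
        @EdbAtom reach_sig _ _ None [tuple 0; 1]].

Definition goal_rule : @rule reach_sig unit (fun=> 1) :=
  @Rule reach_sig unit (fun=> 1) None [tuple]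
    [:: @IdbAtom reach_sig unit (fun=> 1) (Some tt) [tuple 0];
        @EdbAtom reach_sig _ _ (Some true) [tuple 0]].

Definition reach_program : program reach_sig :=
  @Program reach_sig unit (fun=> 1) [:: init_rule; step_rule; goal_rule].

Lemma two_points_rejected : ~ accepts reach_program two_points.
Proof.
(* Invariant of the fixpoint: reachability never leaves the P-point [false], as all edges are loops,
   and the goal is never derived, as [false] is not a Q-point. *)
pose inv p (t : (pred_arity (idb_arity reach_program) p).-tuple two_points) :=
  if p is Some _ then all (pred1 false) t : Prop else False.
suff der_inv p t : derived t -> @inv p t by move/der_inv.
elim=> {p t} r v rP edb _ idb _; case: rP edb idb => [|[|[|[]]]] <- /= edb idb.
- by have := edb _ _ (or_introl erefl); rewrite !inE.
- have := edb _ _ (or_intror (or_introl erefl)); rewrite inE /= andbT => /eqP<-.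
  exact: idb _ _ (or_introl erefl).
- have := edb _ _ (or_intror (or_introl erefl)); rewrite inE /= andbT => /eqP v0.
  by have := idb _ _ (or_introl erefl); rewrite /inv /= v0.
Qed.

Lemma long_path_accepted n : accepts reach_program (long_path n).
Proof.
have reach i (lt_in : i < n.+1) :
    @derived _ reach_program (long_path n) (Some tt) [tuple Ordinal lt_in].
  elim: i lt_in => [|i IHi] lt_in.
    apply: (@derived_rule _ reach_program (long_path n) init_rule
              (fun=> Ordinal lt_in)) => //; first by left.
    by move=> a [<-|[]]; rewrite /= inE.
  (* In [step_rule], variable 0 is the predecessor i and variable 1 the new vertex i+1. *)
  pose v k : long_path n := if k is 0 then Ordinal (ltnW lt_in)
                            else Ordinal lt_in.
  apply: (@derived_rule _ reach_program (long_path n) step_rule v) => //; first by right; left.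
  move=> a [<-|[<-|[]]] /=; last by rewrite inE /= leqnSn leqnn.
  suff -> : map_tuple v [tuple 0] = [tuple Ordinal (ltnW lt_in)] by [].
  exact: val_inj.
apply: (@derived_rule _ reach_program (long_path n) goal_rule (fun=> ord_max)) => //.
  by right; right; left.
move=> a [<-|[<-|[]]] /=; last by rewrite inE /= eqxx.
(* Both sides are the vertex n, with possibly different proofs of the bound. *)
suff -> : map_tuple (fun=> ord_max) [tuple 0] = [tuple Ordinal (ltnSn n)] by [].
by apply: val_inj; congr [:: _]; apply: val_inj.
Qed.

Theorem theorem27 :
  exists (tau : signature) (C : structure tau -> Prop),
    monadic_linear_datalog_definable C /\
    ~ exists A : left_query_algorithm tau, decides A C.
Proof.
exists reach_sig, (accepts reach_program); split.
  by exists reach_program; split=> // r [<-|[<-|[<-|[]]]].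
(* For this n, acceptance of [long_path n] would force acceptance of [two_points]. *)
case=> A /decides_limit/(_ homB_long_path)[n [acc _]].
exact/two_points_rejected/acc/long_path_accepted.
Qed.
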